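(* Let $\Omega$ be a nonempty set, let $(A,\rho_\Omega)$ be an $\Omega$-operated $\mathbf{k}$-algebra and let $B$ be a $\mathbf{k}$-augmented algebra. The pair $((\mathfrak{E}(\Omega,A\otimes B),\veebar),\Gamma_\Omega)$ (with structure map $a\mapsto\bullet_{a\otimes 1}$ and the map $B\to\mathfrak{E}(\Omega,A\otimes B)$, $b\mapsto\bullet_{1\otimes b}$) is the free $(A,\rho_\Omega)$-algebra over $B$.
   Context: $\mathbf{k}$ is a field of characteristic $0$; all algebras are commutative unital $\mathbf{k}$-algebras (except augmentation parts $B^+$, which need not have a unit), and tensor products are over $\mathbf{k}$. An $\Omega$-operated $\mathbf{k}$-algebra is a $\mathbf{k}$-algebra $V$ with $\mathbf{k}$-linear maps $P_\omega:V\to V$, $\omega\in\Omega$; write $P_\Omega=(P_\omega\mid\omega\in\Omega)$. A homomorphism $(V,P_\Omega)\to(U,Q_\Omega)$ is an algebra homomorphism $f$ with $fP_\omega=Q_\omega f$ for all $\omega$. For an $\Omega$-operated algebra $(A,\rho_\Omega)$, an $(A,\rho_\Omega)$-algebra is an $\Omega$-operated algebra $(R,P_\Omega)$ with a homomorphism $j_R:(A,\rho_\Omega)\to(R,P_\Omega)$ of $\Omega$-operated algebras (structure map); homomorphisms of $(A,\rho_\Omega)$-algebras are homomorphisms $f$ of $\Omega$-operated algebras with $fj_R=j_S$. $B$ is $\mathbf{k}$-augmented if $B=\mathbf{k}\oplus B^+$ as a direct sum of $\mathbf{k}$-subalgebras ($B^+$ not required unital). The free $(A,\rho_\Omega)$-algebra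 over $B$ is an $(A,\rho_\Omega)$-algebra $(F,\Pi_\Omega)$ with an algebra homomorphism $i_B:B\to F$ such that for any $(A,\rho_\Omega)$-algebra $(R,P_\Omega)$ and algebra homomorphism $f:B\to R$ there is a unique $(A,\rho_\Omega)$-algebra homomorphism $\bar f:(F,\Pi_\Omega)\to(R,P_\Omega)$ with $\bar f\,i_B=f$. Trees. Put $C:=A\otimes B=A\oplus C_A^+$, $C_A^+:=A\otimes B^+$ ($A$ identified with $A\otimes1$). $\mathcal{T}(\Omega,C)$ is the set of nonplanar rooted trees with vertices decorated by $C$ and edges decorated by $\Omega$; $\mathfrak{T}(\Omega,C)$ is the $\mathbf{k}$-module spanned by $\mathcal{T}(\Omega,C)$, with trees taken to be $\mathbf{k}$-linear in each vertex decoration (free module modulo multilinearity in the vertex decorations). $\bullet_c$ is the one-vertex tree decorated by $c$. The product $T\veebar U$ merges the roots of $T$ and $U$ into a common root carrying all branches of both, decorated by the product of the two root decorations, extended bilinearly. $\Lambda_\omega$ sends $T$ to the tree obtained by adding a new root decorated by $1$ joined to the root of $T$ by an edge decorated by $\omega$. $\mathcal{E}(\Omega,C)\subseteq\mathcal{T}(\Omega,C)$ is the set of decorated trees whose leaf vertices are decorated by elements of $C_A^+$, where the vertex of a one-vertex tree is not considered a leaf and so may be decorated by any element of $C$ (in a tree of height at least one, leaves are the non-root vertices without children). $\mathcal{E}^+(\Omega,C)$ consists of the $\bullet_c$ with $c\in C_A^+$ together with the trees of height at least one in $\mathcal{E}(\Omega,C)$. $\mathfrak{E}(\Omega,C)$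 is the submodule of $\mathfrak{T}(\Omega,C)$ spanned by $\mathcal{E}(\Omega,C)$; it is closed under $\veebar$. For $\omega\in\Omega$, $\Gamma_\omega$ is the linear operator on $\mathfrak{E}(\Omega,C)$ with $\Gamma_\omega(\bullet_a)=\bullet_{\rho_\omega(a)}$ for $a\in A$ and $\Gamma_\omega(T)=\Lambda_\omega(T)$ for $T\in\mathcal{E}^+(\Omega,C)$; $\Gamma_\Omega=(\Gamma_\omega\mid\omega\in\Omega)$. *)

(* Defs.v *)
From HB Require Import structures.
From mathcomp Require Import all_boot all_algebra.
From mathcomp Require Import boolp finmap.
From mathcomp.multinomials Require Import monalg.

Set Implicit Arguments.
Unset Strict Implicit.
Unset Printing Implicit Defensive.

Import GRing.Theory.
Local Open Scope ring_scope.
Local Open Scope quotient_scope.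

(* Commutative unital k-algebras.  The algebra structures of MathComp require
   1 != 0 and cannot be used here, since the zero algebra has to be allowed. *)
HB.mixin Record isComKAlg (k : fieldType) V of GRing.ComPzRing V := {
  kscale : k -> V -> V;
  kscaleA : forall a b v, kscale a (kscale b v) = kscale (a * b) v;
  kscale1 : left_id 1 kscale;
  kscaleDr : right_distributive kscale +%R;
  kscaleDl : forall v, {morph kscale^~ v : a b / a + b};
  kscaleAl : forall a u v, kscale a (u * v) = kscale a u * v
}.

#[short(type="comKAlgType")]
HB.structure Definition ComKAlg (k : fieldType) :=
  {V of GRing.ComPzRing V & isComKAlg k V}.

HB.instance Definition _ (k : fieldType) (V : comKAlgType k) :=
  GRing.Zmodule_isLmodule.Build k (ComKAlg.sort V)
    (@kscaleA k V) (@kscale1 k V) (@kscaleDr k V) (@kscaleDl k V).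

Lemma scale_mull (k : fieldType) (V : comKAlgType k) a (u v : V) :
  a *: (u * v) = a *: u * v.
Proof. exact: kscaleAl. Qed.

Lemma scale_mulr (k : fieldType) (V : comKAlgType k) a (u v : V) :
  a *: (u * v) = u * (a *: v).
Proof. by rewrite mulrC scale_mull mulrC. Qed.

Definition is_alghom (k : fieldType) (U V : comKAlgType k) (f : U -> V) : Prop :=
  linear f /\ monoid_morphism f.

Record opAlg (k : fieldType) (Omega : Type) := OpAlg {
  op_alg :> comKAlgType k;
  oper : Omega -> {linear op_alg -> op_alg}
}.

Definition is_ophom (k : fieldType) (Omega : Type) (V U : opAlg k Omega)
    (f : V -> U) : Prop :=
  is_alghom f /\ forall w x, f (oper V w x) = oper U w (f x).

(* F, with structure map jF : A -> F and iB : B -> F, is the free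
   (A, rho_Omega)-algebra over B. *)
Definition is_free_over (k : fieldType) (Omega : Type) (A : opAlg k Omega)
    (B : comKAlgType k) (F : opAlg k Omega) (jF : A -> F) (iB : B -> F) : Prop :=
  [/\ is_ophom jF, is_alghom iB &
    forall (R : opAlg k Omega) (jR : A -> R) (f : B -> R),
      is_ophom jR -> is_alghom f ->
      exists! g : F -> R,
        [/\ is_ophom g, forall a, g (jF a) = jR a & forall b, g (iB b) = f b]].

Inductive span (k : pzRingType) (V : lmodType k) (S : V -> Prop) : V -> Prop :=
| span0 : span S 0
| span_step a x u : S x -> span S u -> span S (a *: x + u).

Section SpanTheory.
Variables (k : pzRingType) (V : lmodType k) (S : V -> Prop).

Lemma span_gen x : S x -> span S x.
Proof. by move=> Sx; rewrite -[x]scale1r -[_ *: x]addr0; apply: span_step => //; exact: span0. Qed.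

Lemma spanD u v : span S u -> span S v -> span S (u + v).
Proof.
move=> Su Sv; elim: Su => [|a x w Sx _ IH]; first by rewrite add0r.
by rewrite -addrA; apply: span_step.
Qed.

Lemma spanZ a u : span S u -> span S (a *: u).
Proof.
elim=> [|b x w Sx _ IH]; first by rewrite scaler0; exact: span0.
by rewrite scalerDr scalerA; apply: span_step.
Qed.

Lemma spanN u : span S u -> span S (- u).
Proof. by rewrite -scaleN1r; exact: spanZ. Qed.

Lemma spanB u v : span S u -> span S v -> span S (u - v).
Proof. by move=> Su Sv; apply: spanD => //; exact: spanN. Qed.
End SpanTheory.

Lemma span_map (k : pzRingType) (U V : lmodType k) (S : U -> Prop)
    (S' : V -> Prop) (f : U -> V) :
  linear f -> (forall x, S x -> span S' (f x)) ->
  forall u, span S u -> span S' (f u).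
Proof.
move=> lf Sf u; elim=> [|a x w Sx _ IH].
  suff -> : f 0 = 0 by exact: span0.
  by have := lf (-1) 0 0; rewrite scaler0 addr0 scaleN1r addNr.
by rewrite lf; apply: spanD => //; apply: spanZ; apply: Sf.
Qed.

Section LinExt.
Variables (k : fieldType) (X : choiceType) (V : lmodType k) (f : X -> V).

Definition linext (u : {malg k[X]}) : V := \sum_(x <- msupp u) u@_x *: f x.

Lemma linextw (D : {fset X}) (u : {malg k[X]}) :
  fsubset (msupp u) D -> linext u = \sum_(x <- D) u@_x *: f x.
Proof.
move=> sD; rewrite /linext (big_fset_incl _ sD) //= => x _ xu.
by rewrite mcoeff_outdom // scale0r.
Qed.

Lemma linext_linear : linear linext.
Proof.
move=> a u v.
pose D := fsetU (msupp u) (msupp v).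
have su : fsubset (msupp u) D by exact: fsubsetUl.
have sv : fsubset (msupp v) D by exact: fsubsetUr.
have suv : fsubset (msupp (a *: u + v)) D.
  apply: fsubset_trans (msuppD_le _ _) _.
  by apply: fsetSU; exact: msuppZ_le.
rewrite (linextw su) (linextw sv) (linextw suv) scaler_sumr -big_split /=.
apply: eq_bigr => x _.
by rewrite mcoeffD mcoeffZ scalerDl scalerA.
Qed.

HB.instance Definition _ :=
  GRing.isLinear.Build k {malg k[X]} V *:%R linext linext_linear.

Lemma linext0 : linext 0 = 0. Proof. exact: linear0. Qed.
Lemma linextB u v : linext (u - v) = linext u - linext v.
Proof. exact: linearB. Qed.
Lemma linextP a u v : linext (a *: u + v) = a *: linext u + linext v.
Proof. exact: linext_linear. Qed.

Lemma linextU x : linext << x >> = f x.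
Proof.
rewrite /linext msuppU oner_eq0 big_seq_fset1 mcoeffUU.
exact: scale1r.
Qed.
End LinExt.

Lemma malg_lin_ind (k : fieldType) (X : choiceType) (Q : {malg k[X]} -> Prop) :
  Q 0 -> (forall a x u, Q u -> Q (a *: << x >> + u)) -> forall u, Q u.
Proof.
move=> Q0 QD u; rewrite [u]monalgE.
elim: (enum_fset (msupp u)) => [|x s IH]; first by rewrite big_nil.
rewrite big_cons; suff -> : << u@_x *g x >> = u@_x *: << x >> by exact: QD.
by apply/malgP => y; rewrite mcoeffZ !mcoeffU; case: eqP; rewrite ?mulr1 ?mulr0.
Qed.

(* A commutative algebra presented by a commutative monoid M and relations
   z = a x + y between elements of M, stable under multiplication by M: the
   quotient of k[M] by the span of the relators is a k-algebra. *)
Record presentation (k : fieldType) := Presentation {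
  gen :> choiceType;
  gen1 : gen;
  genM : gen -> gen -> gen;
  genMA : associative genM;
  genMC : commutative genM;
  gen1M : left_id gen1 genM;
  genrel : k -> gen -> gen -> gen -> Prop;
  genrelM : forall a x y z t, genrel a x y z ->
    genrel a (genM x t) (genM y t) (genM z t)
}.

Section PresentedAlgebra.
Variables (k : fieldType) (P : presentation k).

Inductive relator : {malg k[P]} -> Prop :=
| Relator a x y z of genrel a x y z : relator (<< z >> - (a *: << x >> + << y >>)).

Definition pequiv (u v : {malg k[P]}) : bool := `[< span relator (u - v) >].

Lemma pequiv_is_equiv : equiv_class_of pequiv.
Proof.
split=> [u|u v|v u w].
- by apply/asboolP; rewrite subrr; exact: span0.
- by apply/asboolP/asboolP => /spanN; rewrite opprB.
- move=> /asboolP uv /asboolP vw; apply/asboolP.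
  by rewrite -(subrK v u) -addrA; exact: spanD.
Qed.

Canonical pequiv_equiv := EquivRelPack pequiv_is_equiv.
Canonical pequiv_encModRel := defaultEncModRel pequiv.

Definition presalg := {eq_quot pequiv}.
HB.instance Definition _ : EqQuotient _ pequiv presalg := EqQuotient.on presalg.
HB.instance Definition _ := Choice.on presalg.

Definition pcls (u : {malg k[P]}) : presalg := \pi_presalg u.

Lemma pclsP u v : pcls u = pcls v <-> span relator (u - v).
Proof. by split=> [/eqmodP/asboolP|uv]; last exact/eqmodP/asboolP. Qed.

Lemma pclsK x : pcls (repr x) = x. Proof. exact: reprK. Qed.

Lemma pcls_repr u : span relator (repr (pcls u) - u).
Proof. by apply/pclsP; rewrite pclsK. Qed.

Lemma pcls_ind (Q : presalg -> Prop) : (forall u, Q (pcls u)) -> forall x, Q x.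
Proof. by move=> H x; rewrite -(pclsK x). Qed.

(* The operations are locked, as unfolding them makes unification diverge. *)
Fact presalg_key : unit. Proof. exact: tt. Qed.

Definition padd : presalg -> presalg -> presalg :=
  locked_with presalg_key (fun x y => pcls (repr x + repr y)).
Definition popp : presalg -> presalg :=
  locked_with presalg_key (fun x => pcls (- repr x)).
Definition pscale : k -> presalg -> presalg :=
  locked_with presalg_key (fun a x => pcls (a *: repr x)).

Lemma paddE u v : padd (pcls u) (pcls v) = pcls (u + v).
Proof.
by rewrite /padd locked_withE; apply/pclsP; rewrite opprD addrACA; apply: spanD; exact: pcls_repr.
Qed.
Lemma poppE u : popp (pcls u) = pcls (- u).
Proof.
by rewrite /popp locked_withE; apply/pclsP; rewrite -opprD; apply: spanN; exact: pcls_repr.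
Qed.
Lemma pscaleE a u : pscale a (pcls u) = pcls (a *: u).
Proof.
rewrite /pscale locked_withE; apply/pclsP; rewrite -scalerBr.
by apply: spanZ; exact: pcls_repr.
Qed.

Fact paddA : associative padd.
Proof.
by elim/pcls_ind=> u; elim/pcls_ind=> v; elim/pcls_ind=> w; rewrite !paddE addrA.
Qed.
Fact paddC : commutative padd.
Proof. by elim/pcls_ind=> u; elim/pcls_ind=> v; rewrite !paddE addrC. Qed.
Fact padd0 : left_id (pcls 0) padd.
Proof. by elim/pcls_ind=> u; rewrite paddE add0r. Qed.
Fact paddN : left_inverse (pcls 0) popp padd.
Proof. by elim/pcls_ind=> u; rewrite poppE paddE addNr. Qed.

HB.instance Definition _ :=
  GRing.isZmodule.Build presalg paddA paddC padd0 paddN.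

Lemma pclsD u v : pcls (u + v) = pcls u + pcls v.
Proof. by rewrite -paddE. Qed.

Fact pscaleA a b x : pscale a (pscale b x) = pscale (a * b) x.
Proof. by elim/pcls_ind: x => u; rewrite !pscaleE scalerA. Qed.
Fact pscale1 : left_id 1 pscale.
Proof. by elim/pcls_ind=> u; rewrite pscaleE scale1r. Qed.
Fact pscaleDr : right_distributive pscale +%R.
Proof.
move=> a; elim/pcls_ind=> u; elim/pcls_ind=> v.
by rewrite -pclsD !pscaleE -pclsD scalerDr.
Qed.
Fact pscaleDl x : {morph pscale^~ x : a b / a + b}.
Proof. by move=> a b; elim/pcls_ind: x => u; rewrite !pscaleE -pclsD scalerDl. Qed.

HB.instance Definition _ :=
  GRing.Zmodule_isLmodule.Build k presalg pscaleA pscale1 pscaleDr pscaleDl.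

Lemma pcls_linear : linear pcls.
Proof. by move=> a u v; rewrite pclsD -pscaleE. Qed.
HB.instance Definition _ :=
  GRing.isLinear.Build k {malg k[P]} presalg *:%R pcls pcls_linear.

Definition pgen (x : P) : presalg := pcls << x >>.

Lemma pgen_rel a x y z : genrel a x y z -> pgen z = a *: pgen x + pgen y.
Proof.
move=> rz; rewrite /pgen -linearP; apply/pclsP; apply: span_gen.
exact: Relator.
Qed.

Lemma presalg_ind (Q : presalg -> Prop) :
  Q 0 -> (forall a x u, Q u -> Q (a *: pgen x + u)) -> forall u, Q u.
Proof.
move=> Q0 QD; elim/pcls_ind; elim/malg_lin_ind; first by rewrite linear0.
by move=> a x u Qu; rewrite linearP; exact: QD.
Qed.

Section Lift.
Variables (V : lmodType k) (f : P -> V).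
Hypothesis fP : forall a x y z, genrel a x y z -> f z = a *: f x + f y.

Definition plift (u : presalg) : V := linext f (repr u).

Lemma linext_rel u : span relator u -> linext f u = 0.
Proof.
elim=> [|a r v [b x y z rz] _ IH]; first exact: linext0.
by rewrite linextP IH addr0 linextB linextP !linextU (fP rz) subrr scaler0.
Qed.

Lemma plift_cls u : plift (pcls u) = linext f u.
Proof. by apply/eqP; rewrite -subr_eq0 -linextB linext_rel //; exact: pcls_repr. Qed.

Lemma plift_linear : linear plift.
Proof.
move=> a; elim/pcls_ind=> u; elim/pcls_ind=> v.
by rewrite -linearP !plift_cls linextP.
Qed.

Lemma plift_gen x : plift (pgen x) = f x.
Proof. by rewrite plift_cls linextU. Qed.
End Lift.

Definition bilext (u v : {malg k[P]}) : presalg :=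
  linext (fun x => linext (fun y => pgen (genM x y)) v) u.

Definition pmul : presalg -> presalg -> presalg :=
  locked_with presalg_key (fun x y => bilext (repr x) (repr y)).

Lemma bilextC u v : bilext u v = bilext v u.
Proof.
rewrite /bilext; elim/malg_lin_ind: u => [|a x u IH].
  rewrite linext0; elim/malg_lin_ind: v => [|a x v IH]; first by rewrite linext0.
  by rewrite linextP -IH linextU linext0 scaler0 addr0.
rewrite linextP IH linextU; elim/malg_lin_ind: v {IH} => [|b y v IH].
  by rewrite !linext0 scaler0 addr0.
rewrite !linextP !linextU linextP linextU -IH genMC !scalerDr !scalerA (mulrC a).
by rewrite addrACA.
Qed.

Lemma bilext_rel u v : span relator u -> bilext u v = 0.
Proof.
apply: linext_rel => a x y z rz.
elim/malg_lin_ind: v => [|b t v IH]; first by rewrite !linext0 scaler0 addr0.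
rewrite !linextP !linextU IH (pgen_rel (genrelM t rz)).
by rewrite !scalerDr !scalerA (mulrC a) addrACA.
Qed.

Lemma pmulE u v : pmul (pcls u) (pcls v) = bilext u v.
Proof.
have bl (w w' t : {malg k[P]}) : span relator (w - w') -> bilext w t = bilext w' t.
  move=> ww; apply/eqP; rewrite -subr_eq0 -[_ - _]linextB.
  by rewrite -/(bilext _ _) bilext_rel.
rewrite /pmul locked_withE (bl _ u _ (pcls_repr u)) bilextC (bl _ v _ (pcls_repr v)).
exact: bilextC.
Qed.

Lemma pmul_gen x y : pmul (pgen x) (pgen y) = pgen (genM x y).
Proof. by rewrite pmulE /bilext !linextU. Qed.

Fact pmulC : commutative pmul.
Proof. by elim/pcls_ind=> u; elim/pcls_ind=> v; rewrite !pmulE bilextC. Qed.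

Lemma pmulPl a x y z : pmul (a *: x + y) z = a *: pmul x z + pmul y z.
Proof.
elim/pcls_ind: x => u; elim/pcls_ind: y => v; elim/pcls_ind: z => w.
by rewrite -linearP !pmulE /bilext linextP.
Qed.

Fact pmulDl : left_distributive pmul +%R.
Proof. by move=> x y z; rewrite -[x]scale1r pmulPl !scale1r. Qed.

Lemma pmul0 x : pmul 0 x = 0.
Proof. by apply: (addIr (pmul 0 x)); rewrite -pmulDl !add0r. Qed.

Lemma pmulZ a x y : a *: pmul x y = pmul (a *: x) y.
Proof. by rewrite -[a *: x]addr0 pmulPl pmul0 addr0. Qed.

Fact pmul1 : left_id (pgen (gen1 P)) pmul.
Proof.
move=> u; rewrite pmulC; elim/presalg_ind: u => [|a x u IH]; first exact: pmul0.
by rewrite pmulPl IH pmul_gen genMC gen1M.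
Qed.

Lemma pmul0r x : pmul x 0 = 0. Proof. by rewrite pmulC pmul0. Qed.

Lemma pmulPr a x y z : pmul z (a *: x + y) = a *: pmul z x + pmul z y.
Proof. by rewrite !(pmulC z) pmulPl. Qed.

Fact pmulA : associative pmul.
Proof.
move=> u v w; elim/presalg_ind: u => [|a x u IH]; first by rewrite !pmul0.
rewrite !pmulPl IH; congr (_ *: _ + _) => {a u IH}.
elim/presalg_ind: v => [|a y u IH]; first by rewrite pmul0r !pmul0 pmul0r.
rewrite pmulPl !pmulPr pmulPl IH; congr (_ *: _ + _) => {a u IH}.
elim/presalg_ind: w => [|a z u IH]; first by rewrite !pmul0r.
by rewrite !pmulPr IH !pmul_gen genMA.
Qed.

HB.instance Definition _ :=
  GRing.Zmodule_isComPzRing.Build presalg pmulA pmulC pmul1 pmulDl.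
HB.instance Definition _ := isComKAlg.Build k presalg
  pscaleA pscale1 pscaleDr pscaleDl pmulZ.

Lemma pgenM x y : pgen (genM x y) = pgen x * pgen y.
Proof. by rewrite -pmul_gen. Qed.

Lemma pgen1 : pgen (gen1 P) = 1.
Proof. by []. Qed.
End PresentedAlgebra.

Section TensorProduct.
Variables (k : fieldType) (A B : comKAlgType k).

Inductive tensor_rel (l : k) : A * B -> A * B -> A * B -> Prop :=
| tensor_rel_l a1 a2 b : tensor_rel l (a1, b) (a2, b) (l *: a1 + a2, b)
| tensor_rel_r a b1 b2 : tensor_rel l (a, b1) (a, b2) (a, l *: b1 + b2).

Definition tensorM (x y : A * B) : A * B := (x.1 * y.1, x.2 * y.2).

Fact tensorMA : associative tensorM.
Proof. by move=> x y z; rewrite /tensorM !mulrA. Qed.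
Fact tensorMC : commutative tensorM.
Proof. by move=> x y; congr (_, _); rewrite mulrC. Qed.
Fact tensor1M : left_id (1, 1) tensorM.
Proof. by case=> a b; rewrite /tensorM !mul1r. Qed.
Fact tensor_relM l x y z t : tensor_rel l x y z ->
  tensor_rel l (tensorM x t) (tensorM y t) (tensorM z t).
Proof.
by case=> [a1 a2 b|a b1 b2]; rewrite /tensorM /= mulrDl -scale_mull; constructor.
Qed.

Definition tensor_presentation : presentation k :=
  Presentation tensorMA tensorMC tensor1M tensor_relM.

Definition tensor : comKAlgType k := presalg tensor_presentation.

Definition tens (a : A) (b : B) : tensor := pgen (P := tensor_presentation) (a, b).

Lemma tensPl l a1 a2 b : tens (l *: a1 + a2) b = l *: tens a1 b + tens a2 b.
Proof. by apply: (@pgen_rel _ tensor_presentation); exact: tensor_rel_l. Qed.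

Lemma tensPr l a b1 b2 : tens a (l *: b1 + b2) = l *: tens a b1 + tens a b2.
Proof. by apply: (@pgen_rel _ tensor_presentation); exact: tensor_rel_r. Qed.

Lemma tens0l b : tens 0 b = 0.
Proof. by have := tensPl (-1) 0 0 b; rewrite scaler0 addr0 scaleN1r addNr. Qed.

Lemma tens0r a : tens a 0 = 0.
Proof. by have := tensPr (-1) a 0 0; rewrite scaler0 addr0 scaleN1r addNr. Qed.

Lemma tensZl l a b : tens (l *: a) b = l *: tens a b.
Proof. by rewrite -[l *: a]addr0 tensPl tens0l addr0. Qed.

Lemma tensZr l a b : tens a (l *: b) = l *: tens a b.
Proof. by rewrite -[l *: b]addr0 tensPr tens0r addr0. Qed.

Lemma tensM a1 b1 a2 b2 : tens a1 b1 * tens a2 b2 = tens (a1 * a2) (b1 * b2).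
Proof. by rewrite /tens -pgenM. Qed.

Lemma tens1 : tens 1 1 = 1. Proof. by []. Qed.

Lemma tensor_ind (Q : tensor -> Prop) :
  Q 0 -> (forall l a b u, Q u -> Q (l *: tens a b + u)) -> forall u, Q u.
Proof. by move=> Q0 QD; apply: presalg_ind => // l [a b] u; exact: QD. Qed.
End TensorProduct.

(* Uniqueness in aug_decomp makes the sum direct and k -> B injective. *)
Record augmentation (k : fieldType) (B : comKAlgType k) (Bp : B -> Prop) : Prop :=
  Augmentation {
    aug0 : Bp 0;
    augP : forall (l : k) x y, Bp x -> Bp y -> Bp (l *: x + y);
    augM : forall x y, Bp x -> Bp y -> Bp (x * y);
    aug_decomp : forall b : B,
      exists! p : k * B, Bp p.2 /\ b = p.1 *: (1 : B) + p.2
  }.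

(* Planar representatives: a root decoration and a list of branches, each with
   the decoration of the edge that joins it to the root. *)
Inductive ptree (Omega C : Type) : Type :=
  PNode of C & seq (Omega * ptree Omega C).

HB.instance Definition _ (Omega C : Type) := gen_eqMixin (ptree Omega C).
HB.instance Definition _ (Omega C : Type) := gen_choiceMixin (ptree Omega C).

Section Trees.
Variables (k : fieldType) (Omega : Type) (C : comKAlgType k).
Local Notation pt := (ptree Omega C).

(* Two planar trees have the same underlying nonplanar tree. *)
Inductive reorder : pt -> pt -> Prop :=
| reorder_refl t : reorder t t
| reorder_sym t u : reorder t u -> reorder u t
| reorder_trans t u v : reorder t u -> reorder u v -> reorder t v
| reorder_swap c s1 b1 b2 s2 :
    reorder (PNode c (s1 ++ b1 :: b2 :: s2)) (PNode c (s1 ++ b2 :: b1 :: s2))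
| reorder_branch c s1 w t u s2 : reorder t u ->
    reorder (PNode c (s1 ++ (w, t) :: s2)) (PNode c (s1 ++ (w, u) :: s2)).

Definition reorderb (t u : pt) : bool := `[< reorder t u >].

Lemma reorderb_is_equiv : equiv_class_of reorderb.
Proof.
split=> [t|t u|t u v].
- by apply/asboolP; exact: reorder_refl.
- by apply/asboolP/asboolP; exact: reorder_sym.
- by move=> /asboolP tu /asboolP uv; apply/asboolP; exact: reorder_trans uv.
Qed.

Canonical reorderb_equiv := EquivRelPack reorderb_is_equiv.
Canonical reorderb_encModRel := defaultEncModRel reorderb.

Definition tree := {eq_quot reorderb}.
HB.instance Definition _ : EqQuotient _ reorderb tree := EqQuotient.on tree.
HB.instance Definition _ := Choice.on tree.

Definition tcls (t : pt) : tree := \pi_tree t.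

Lemma tclsP t u : tcls t = tcls u <-> reorder t u.
Proof. by split=> [/eqmodP/asboolP|tu]; last exact/eqmodP/asboolP. Qed.

Lemma tclsK T : tcls (repr T) = T. Proof. exact: reprK. Qed.

Lemma repr_tcls t : reorder (repr (tcls t)) t.
Proof. by apply/tclsP; rewrite tclsK. Qed.

Lemma tcls_ind (Q : tree -> Prop) : (forall t, Q (tcls t)) -> forall T, Q T.
Proof. by move=> H T; rewrite -(tclsK T). Qed.

Definition pmerge (t u : pt) : pt :=
  let: PNode c s := t in let: PNode d r := u in PNode (c * d) (s ++ r).

Definition merge (T U : tree) : tree := tcls (pmerge (repr T) (repr U)).

Definition dot (c : C) : tree := tcls (PNode c [::]).

Definition graft (w : Omega) (T : tree) : tree := tcls (PNode 1 [:: (w, repr T)]).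

Lemma graftE w t : graft w (tcls t) = tcls (PNode 1 [:: (w, t)]).
Proof. by apply/tclsP; apply: (@reorder_branch 1 [::] w _ _ [::]); exact: repr_tcls. Qed.

Lemma reorder_cat c s r : reorder (PNode c (s ++ r)) (PNode c (r ++ s)).
Proof.
suff H p : reorder (PNode c (p ++ s ++ r)) (PNode c (p ++ r ++ s)) by exact: (H [::]).
elim: s p => [|b s IH] p; first by rewrite cats0; exact: reorder_refl.
have := IH (rcons p b); rewrite -!cats1 -!catA /= => h.
apply: reorder_trans h _ => {IH}.
elim: r p => [|b' r IH] p; first exact: reorder_refl.
apply: reorder_trans (reorder_swap _ _ _ _ _) _.
by have := IH (rcons p b'); rewrite -!cats1 -!catA.
Qed.

Lemma pmergeC t u : reorder (pmerge t u) (pmerge u t).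
Proof. by case: t u => [c s] [d r] /=; rewrite mulrC; exact: reorder_cat. Qed.

Lemma reorder_pmerge t t' u : reorder t t' -> reorder (pmerge t u) (pmerge t' u).
Proof.
move=> tt; elim: tt u => {t t'}.
- by move=> t u; exact: reorder_refl.
- by move=> t t' _ IH u; apply: reorder_sym.
- by move=> t t' t'' _ IH _ IH' u; apply: reorder_trans (IH u) (IH' u).
- by move=> c s1 b1 b2 s2 [d r] /=; rewrite -!catA /=; exact: reorder_swap.
- by move=> c s1 w t t' s2 tt _ [d r] /=; rewrite -!catA /=; exact: reorder_branch.
Qed.

Lemma mergeE t u : merge (tcls t) (tcls u) = tcls (pmerge t u).
Proof.
apply/tclsP; apply: reorder_trans (reorder_pmerge _ (repr_tcls t)) _.
apply: reorder_trans (pmergeC _ _) _.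
apply: reorder_trans (reorder_pmerge _ (repr_tcls u)) _.
exact: pmergeC.
Qed.

Fact mergeA : associative merge.
Proof.
elim/tcls_ind=> t; elim/tcls_ind=> u; elim/tcls_ind=> v; rewrite !mergeE.
by case: t u v => [c s] [d r] [e q] /=; rewrite mulrA catA.
Qed.
Fact mergeC : commutative merge.
Proof.
by elim/tcls_ind=> t; elim/tcls_ind=> u; rewrite !mergeE; apply/tclsP/pmergeC.
Qed.
Fact dot1_merge : left_id (dot 1) merge.
Proof. by elim/tcls_ind=> -[c s]; rewrite mergeE /= mul1r. Qed.

(* The three trees agree except at one vertex, where the decoration of the
   third is l times that of the first plus that of the second. *)
Inductive ptree_rel (l : k) : pt -> pt -> pt -> Prop :=
| ptree_rel_root c1 c2 s :
    ptree_rel l (PNode c1 s) (PNode c2 s) (PNode (l *: c1 + c2) s)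
| ptree_rel_branch c s1 w t1 t2 t s2 : ptree_rel l t1 t2 t ->
    ptree_rel l (PNode c (s1 ++ (w, t1) :: s2)) (PNode c (s1 ++ (w, t2) :: s2))
      (PNode c (s1 ++ (w, t) :: s2)).

Inductive tree_rel (l : k) : tree -> tree -> tree -> Prop :=
| Tree_rel t1 t2 t of ptree_rel l t1 t2 t :
    tree_rel l (tcls t1) (tcls t2) (tcls t).

Fact tree_relM l T1 T2 T U : tree_rel l T1 T2 T ->
  tree_rel l (merge T1 U) (merge T2 U) (merge T U).
Proof.
case=> t1 t2 t rt; elim/tcls_ind: U => u; rewrite !mergeE; constructor.
case: rt u => [c1 c2 s|c s1 w u1 u2 u' s2 ru] [d r] /=.
  by rewrite mulrDl -scale_mull; exact: ptree_rel_root.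
by rewrite -!catA /=; exact: ptree_rel_branch.
Qed.

Definition tree_presentation : presentation k :=
  Presentation mergeA mergeC dot1_merge tree_relM.

Definition tree_alg : comKAlgType k := presalg tree_presentation.

Definition tgen (T : tree) : tree_alg := pgen (P := tree_presentation) T.

Lemma tgen_rel l t1 t2 t : ptree_rel l t1 t2 t ->
  tgen (tcls t) = l *: tgen (tcls t1) + tgen (tcls t2).
Proof. by move=> rt; apply: (@pgen_rel _ tree_presentation); constructor. Qed.

Lemma tgenM T U : tgen (merge T U) = tgen T * tgen U.
Proof. by rewrite /tgen -pgenM. Qed.

Lemma tgen1 : tgen (dot 1) = 1. Proof. by []. Qed.
End Trees.

Section ETrees.
Variables (k : fieldType) (Omega : Type) (C : comKAlgType k) (Cp : C -> Prop).

(* Decorations of the leaves of a branch: unlike in a tree, the root of a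
   branch without children is a leaf. *)
Fixpoint branch_leaves (t : ptree Omega C) : seq C :=
  let: PNode c s := t in
  if s is [::] then [:: c] else flatten [seq branch_leaves b.2 | b <- s].

Definition leaves (t : ptree Omega C) : seq C :=
  let: PNode _ s := t in flatten [seq branch_leaves b.2 | b <- s].

Definition in_E (T : tree Omega C) : Prop :=
  exists2 t, T = tcls t & forall c, c \in leaves t -> Cp c.

(* A tree has height at least one when it is not a one-vertex tree. *)
Definition in_Eplus (T : tree Omega C) : Prop :=
  (exists2 c, Cp c & T = dot Omega c) \/ in_E T /\ forall c, T <> dot Omega c.

Lemma dot_in_E c : in_E (dot Omega c).
Proof. by exists (PNode c [::]). Qed.

Lemma merge_in_E T U : in_E T -> in_E U -> in_E (merge T U).
Proof.
move=> [t -> Et] [u -> Eu]; exists (pmerge t u); first exact: mergeE.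
case: t u Et Eu => [c s] [d r] /= Et Eu e.
by rewrite map_cat flatten_cat mem_cat => /orP[/Et|/Eu].
Qed.

Definition Espan : {pred tree_alg Omega C} :=
  fun x => `[< span (fun y => exists2 T, in_E T & y = tgen T) x >].

Lemma EspanP x :
  reflect (span (fun y => exists2 T, in_E T & y = tgen T) x) (x \in Espan).
Proof. exact: asboolP. Qed.

Lemma tgen_Espan T : in_E T -> tgen T \in Espan.
Proof. by move=> ET; apply/EspanP/span_gen; exists T. Qed.

Lemma Espan_scale a x : x \in Espan -> a *: x \in Espan.
Proof. by move=> /EspanP Ex; apply/EspanP/spanZ. Qed.

Fact Espan_subring : subring_closed Espan.
Proof.
split; first exact/tgen_Espan/dot_in_E.
  by move=> x y /EspanP Ex /EspanP Ey; apply/EspanP/spanB.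
move=> x y /EspanP Ex /EspanP Ey; apply/EspanP.
elim: Ex => [|a _ u [T ET ->] _ IH]; first by rewrite mul0r; exact: span0.
rewrite mulrDl; apply: spanD IH; rewrite -scale_mull; apply: spanZ.
elim: Ey => [|b _ v [U EU ->] _ IH]; first by rewrite mulr0; exact: span0.
rewrite mulrDr; apply: spanD IH; rewrite -scale_mulr; apply: spanZ.
by apply: span_gen; exists (merge T U); [exact: merge_in_E | rewrite tgenM].
Qed.

Fact Espan_submod : submod_closed Espan.
Proof.
split; first by apply/EspanP; exact: span0.
move=> a x y Ex /EspanP Ey; apply/EspanP; apply: spanD => //.
by apply/EspanP; exact: Espan_scale.
Qed.

Record E_sub := EAlg { E_val : tree_alg Omega C; E_valP : E_val \in Espan }.

HB.instance Definition _ := [isSub for E_val].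
HB.instance Definition _ := [Choice of E_sub by <:].
HB.instance Definition _ := GRing.SubChoice_isSubComPzRing.Build
  (tree_alg Omega C) Espan E_sub Espan_subring.
HB.instance Definition _ := GRing.SubZmodule_isSubLmodule.Build
  k (tree_alg Omega C) Espan E_sub Espan_submod.

Lemma E_valI : injective E_val. Proof. exact: val_inj. Qed.
Lemma E_valZ (a : k) (u : E_sub) : E_val (a *: u) = a *: E_val u.
Proof. exact: GRing.valZ. Qed.
Lemma E_valD (u v : E_sub) : E_val (u + v) = E_val u + E_val v.
Proof. exact: (raddfD val). Qed.
Lemma E_valM (u v : E_sub) : E_val (u * v) = E_val u * E_val v.
Proof. exact: (rmorphM val). Qed.

Fact E_scaleAl (a : k) (u v : E_sub) : a *: (u * v) = a *: u * v.
Proof. by apply: E_valI; rewrite E_valZ !E_valM E_valZ scale_mull. Qed.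

HB.instance Definition _ := isComKAlg.Build k E_sub
  (@scalerA k E_sub) (@scale1r k E_sub) (@scalerDr k E_sub)
  (fun v => scalerDl v) E_scaleAl.

Definition E_alg : comKAlgType k := E_sub.

Lemma E_val_alghom : is_alghom (E_val : E_alg -> tree_alg Omega C).
Proof.
split; last by split=> [|x y]; [exact: (rmorph1 val) | exact: E_valM].
by move=> a x y; rewrite -E_valZ; exact: E_valD.
Qed.

Definition E_dot (c : C) : E_alg := EAlg (tgen_Espan (dot_in_E c)).
End ETrees.

Section Gamma.
Variables (k : fieldType) (Omega : Type) (A : opAlg k Omega).
Variables (B : comKAlgType k) (Bp : B -> Prop).

(* A (x) B^+, as a subspace of A (x) B *)
Definition tensor_plus : tensor A B -> Prop :=
  span (fun c => exists a, exists2 b, Bp b & c = tens a b).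

Local Notation E := (E_alg Omega tensor_plus).
Local Notation tree := (tree Omega (tensor A B)).

Definition Gamma_spec (w : Omega) (G : {linear E -> E}) : Prop :=
  (forall a : A, G (E_dot _ _ (tens a 1)) = E_dot _ _ (tens (oper A w a) 1)) /\
  (forall (T : tree) (x : E), in_Eplus tensor_plus T ->
    E_val x = tgen T -> E_val (G x) = tgen (graft w T)).

Hypothesis augB : augmentation Bp.

Lemma aug_proj : exists2 e : B -> k,
  forall (l : k) x y, e (l *: x + y) = l * e x + e y &
  e 1 = 1 /\ forall b, (Bp b -> e b = 0) /\ Bp (b - e b *: (1 : B)).
Proof.
pose e b := (projT1 (cid (aug_decomp augB b))).1.
have eP b (p : k * B) : Bp p.2 -> b = p.1 *: (1 : B) + p.2 -> e b = p.1.
  move=> Bpp bE; rewrite /e; case: cid => q /= [_ uq].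
  by rewrite (uq p) //; split.
have eB b : Bp (b - e b *: (1 : B)).
  rewrite /e; case: cid => -[l b'] /= [[Bb ->] _].
  by rewrite addrC addKr.
exists e; last first.
  split; first by apply: (eP _ (1, 0)); [exact: (aug0 augB) | rewrite scale1r addr0].
  split=> // Bb; apply: (eP _ (0, b)) => //.
  by rewrite scale0r add0r.
move=> l x y.
pose b' : B := l *: (x - e x *: (1 : B)) + (y - e y *: (1 : B)).
apply: (eP _ (l * e x + e y, b')); first exact: (augP augB).
rewrite /b' /= scalerBr scalerDl scalerA addrACA.
by rewrite (addrC _ (l *: x - _)) subrK (addrC _ (y - _)) subrK.
Qed.

Lemma tensor_proj : exists2 p : tensor A B -> A, linear p &
  [/\ forall a, p (tens a 1) = a, forall c, tensor_plus c -> p c = 0 &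
      forall c, tensor_plus (c - tens (p c) 1)].
Proof.
have [e eP [e1 eB]] := aug_proj.
pose f (x : tensor_presentation A B) : A := e x.2 *: x.1.
have fP l x y z : genrel l x y z -> f z = l *: f x + f y.
  case=> [a1 a2 b|a b1 b2]; rewrite /f /=.
    by rewrite scalerDr !scalerA mulrC.
  by rewrite eP scalerDl scalerA.
have pL : linear (plift f) := plift_linear fP.
have pT a b : plift f (tens a b) = e b *: a by rewrite plift_gen.
have p0 : plift f 0 = 0.
  by have := pL (-1) 0 0; rewrite scaler0 addr0 scaleN1r addNr.
exists (plift f) => //; split=> [a|c|c].
- by rewrite pT e1 scale1r.
- elim=> [//|l _ u [a [b Bb ->]] _ IH].
  by rewrite pL IH pT (eB b).1 // scale0r scaler0 addr0.
- elim/tensor_ind: c => [|l a b u IH].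
    by rewrite p0 tens0l subr0; exact: span0.
  rewrite pL pT tensPl opprD addrACA; apply: spanD IH.
  rewrite -scalerBr; apply: spanZ; apply: span_gen.
  exists a, (b - e b *: (1 : B)); first exact: (eB b).2.
  have -> : b - e b *: (1 : B) = (- e b) *: (1 : B) + b by rewrite scaleNr addrC.
  by rewrite tensPr tensZl scaleNr addrC.
Qed.

(* On one-vertex trees, split the decoration along A (x) B = A (+) A (x) B^+. *)
Lemma Gamma_exists (w : Omega) : exists G : {linear E -> E}, Gamma_spec w G.
Proof.
have [p pL [pA p0 pP]] := tensor_proj.
pose one := fun c : tensor A B => tgen (dot Omega (tens (oper A w (p c)) 1)) +
  tgen (graft w (dot Omega (c - tens (p c) 1))).
pose gp (t : ptree Omega (tensor A B)) := 
  if t is PNode c [::] then one c else tgen (graft w (tcls t)).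
have gpE t u : reorder t u -> gp t = gp u.
  elim=> {t u} // [t u v _ -> _ -> //|c s1 b1 b2 s2|c s1 v t u s2 tu _].
    have cE : tcls (PNode c (s1 ++ b1 :: b2 :: s2)) =
        tcls (PNode c (s1 ++ b2 :: b1 :: s2)) by apply/tclsP; exact: reorder_swap.
    by case: s1 cE => [|b s1] /= ->.
  have cE : tcls (PNode c (s1 ++ (v, t) :: s2)) =
      tcls (PNode c (s1 ++ (v, u) :: s2)) by apply/tclsP; exact: reorder_branch.
  by case: s1 cE => [|b s1] /= ->.
pose g (T : tree_presentation Omega (tensor A B)) := gp (repr T).
have gE t : g (tcls t) = gp t by apply: gpE; exact: repr_tcls.
have dotP l c1 c2 : tgen (dot Omega (l *: c1 + c2)) =
    l *: tgen (dot Omega c1) + tgen (dot Omega c2) :> tree_alg Omega (tensor A B).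
  by apply: tgen_rel; exact: ptree_rel_root.
have graftP l t1 t2 t : ptree_rel l t1 t2 t -> 
    tgen (graft w (tcls t)) =
    l *: tgen (graft w (tcls t1)) + tgen (graft w (tcls t2))
    :> tree_alg Omega (tensor A B).
  move=> rt; rewrite !graftE; apply: tgen_rel.
  exact: (@ptree_rel_branch _ _ _ _ _ [::] _ _ _ _ [::]).
have dot0 : tgen (dot Omega 0) = 0 :> tree_alg Omega (tensor A B).
  by have := dotP (-1) 0 0; rewrite scaler0 addr0 scaleN1r addNr.
have graft0 : tgen (graft w (dot Omega 0)) = 0 :> tree_alg Omega (tensor A B).
  have := graftP (-1) _ _ _ (ptree_rel_root _ 0 0 [::]).
  by rewrite scaler0 addr0 scaleN1r addNr.
have gP l x y z : genrel l x y z -> g z = l *: g x + g y.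
  case=> t1 t2 t rt; rewrite !gE.
  have gr := graftP _ _ _ _ rt.
  case: rt gr => [c1 c2 [|b s]|c [|b s1] v u1 u2 u s2 ru] //= _.
  rewrite /one pL linearP tensPl dotP.
  have -> : l *: c1 + c2 - tens (l *: p c1 + p c2) 1 =
      l *: (c1 - tens (p c1) 1) + (c2 - tens (p c2) 1).
    by rewrite tensPl scalerBr opprD addrACA.
  by rewrite (graftP l _ _ _ (ptree_rel_root _ _ _ _)) scalerDr addrACA.
clearbody g.
have GL : linear (plift g) := plift_linear gP.
have GE (x : E) : plift g (E_val x) \in Espan (Omega := Omega) tensor_plus.
  apply/EspanP; move: (EspanP _ _ (E_valP x)).
  apply: span_map GL _ _ => _ [T [t -> Et] ->].
  rewrite (plift_gen gP) gE; case: t Et => c [|b s] Et /=; last first.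
    apply: span_gen; exists (graft w (tcls (PNode c (b :: s)))) => //.
    rewrite graftE; exists (PNode 1 [:: (w, PNode c (b :: s))]) => //= d.
    by rewrite cats0; exact: Et.
  apply: spanD; apply: span_gen.
    by exists (dot Omega (tens (oper A w (p c)) 1)) => //; exact: dot_in_E.
  exists (graft w (dot Omega (c - tens (p c) 1))) => //.
  rewrite graftE; exists (PNode 1 [:: (w, PNode (c - tens (p c) 1) [::])]) => //= d.
  by rewrite inE => /eqP ->; exact: pP.
pose G0 (x : E) : E := EAlg (GE x).
have G0L : linear G0.
  move=> l x y; apply: E_valI.
  have [EL _] := E_val_alghom Omega tensor_plus.
  by rewrite EL /= -GL -EL.
pose Gm := GRing.isLinear.Build k E E *:%R G0 G0L.
pose G : {linear E -> E} := HB.pack G0 Gm.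
exists G; split.
  move=> a; apply: E_valI => /=.
  rewrite (plift_gen gP) gE /= /one pA subrr.
  by rewrite graft0 addr0.
move=> T x ET xE; rewrite /= xE (plift_gen gP).
case: ET => [[c Cc ->]|[[t -> Et] ndot]]; rewrite gE; last first.
  by case: t Et ndot => c [|b s] // _ /(_ c).
by rewrite /= /one p0 // linear0 tens0l subr0 dot0 add0r.
Qed.

Lemma Gamma_unique (w : Omega) (G G' : {linear E -> E}) :
  Gamma_spec w G -> Gamma_spec w G' -> G =1 G'.
Proof.
move=> [GA GT] [GA' GT'] x.
have [p _ [_ _ pP]] := tensor_proj.
have [EL _] := E_val_alghom Omega tensor_plus.
suff H : forall u, span (fun y => exists2 T, in_E tensor_plus T & y = tgen T) u ->
    forall y : E, E_val y = u -> G y = G' y.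
  exact: (H (E_val x) (EspanP _ _ (E_valP x))).
move=> {x} u; elim=> [y y0|l _ v [T ET ->] Ev IH y yE].
  have -> : y = 0 by apply: E_valI; rewrite y0; exact/esym/(raddf0 val).
  by rewrite !linear0.
pose yT : E := EAlg (tgen_Espan ET).
pose yv : E := EAlg (introT (EspanP _ _) Ev).
have -> : y = l *: yT + yv by apply: E_valI; rewrite EL yE.
rewrite !linearP (IH yv) //; congr (_ *: _ + _).
have GG z S : in_Eplus tensor_plus S -> E_val z = tgen S -> G z = G' z.
  by move=> ES zS; apply: E_valI; rewrite (GT _ _ ES zS) (GT' _ _ ES zS).
have [[c Tc]|ndot] := pselect (exists c, T = dot Omega c); last first.
  by apply: (GG _ T) => //; right; split=> // c Tc; apply: ndot; exists c.
pose y1 : E := E_dot _ _ (tens (p c) 1).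
pose y2 : E := E_dot _ _ (c - tens (p c) 1).
have -> : yT = 1 *: y1 + y2.
  have cE : c = 1 *: tens (p c) 1 + (c - tens (p c) 1).
    by rewrite scale1r addrC subrK.
  apply: E_valI; rewrite EL /= Tc [X in tgen (dot Omega X) = _]cE.
  by apply: tgen_rel; exact: ptree_rel_root.
rewrite !linearP; congr (_ *: _ + _); first by rewrite GA GA'.
by apply: (GG _ (dot Omega (c - tens (p c) 1))) => //; left; exists (c - tens (p c) 1).
Qed.

Definition Gamma (w : Omega) : {linear E -> E} := projT1 (cid (Gamma_exists w)).

Lemma GammaP w : Gamma_spec w (Gamma w).
Proof. exact: projT2 (cid (Gamma_exists w)). Qed.

Definition free_opAlg : opAlg k Omega := OpAlg Gamma.
End Gamma.

(* Main.v *)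
Require Import Defs.
From mathcomp Require Import all_boot all_algebra.
From mathcomp Require Import boolp.

(** Evaluation in an operated algebra [R] reads a decorated tree as a formula:
    a vertex decorated by [c] with branches [(w, t)] stands for the image of
    [c] in [R], under the map [A (x) B -> R] that [jR] and [f] determine, times
    the product of the [P_w] of the values of the [t].  This makes sense for
    every decorated tree, is linear in each decoration, and turns the merging
    of roots into products, so it is an algebra morphism on the whole tree
    algebra ([tree_eval_alghom]).  It sends the grafting [Lambda_w] to [P_w]; on
    a one-vertex tree decorated by [A], where [Gamma_w] applies [rho_w]
    instead, it commutes with the operators because [jR] does
    ([tree_eval_Gamma]).  So its restriction to the trees whose leaves lie in
    [A (x) B^+] gives existence.

    It is for uniqueness that the leaves must be restricted: the branches of a
    tree in [E] lie in [E^+], where [Gamma_w] is [Lambda_w], so every such tree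
    is obtained from one-vertex trees by products and the operators [Gamma_w]
    ([free_opAlg_ind]).  Hence a morphism is determined by its values on
    [A] and [B]. *)

Set Implicit Arguments.
Unset Strict Implicit.
Unset Printing Implicit Defensive.

Import GRing.Theory.
Local Open Scope ring_scope.

(** * Morphisms out of presented algebras *)

Lemma plift_alghom (k : fieldType) (P : presentation k) (V : comKAlgType k)
    (f : P -> V) :
  (forall a x y z, genrel a x y z -> f z = a *: f x + f y) ->
  f (gen1 P) = 1 -> (forall x y, f (genM x y) = f x * f y) ->
  is_alghom (plift f).
Proof.
move=> fP f1 fM; have fL := plift_linear fP.
have f0 : plift f 0 = 0.
  by have := fL (-1) 0 0; rewrite scaler0 addr0 scaleN1r addNr.
split=> //; split=> [|u v]; first by rewrite -pgen1 plift_gen.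
elim/presalg_ind: u => [|a x u IH]; first by rewrite mul0r f0 mul0r.
rewrite mulrDl -scale_mull !fL mulrDl -scale_mull IH; congr (_ *: _ + _).
elim/presalg_ind: v {IH} => [|b y v IH]; first by rewrite mulr0 f0 mulr0.
rewrite mulrDr -scale_mulr !fL mulrDr -scale_mulr IH; congr (_ *: _ + _).
by rewrite -pgenM !plift_gen.
Qed.

(** The existence half of the universal property of the tensor product as the
    coproduct of commutative algebras. *)
Lemma tensor_alghom (k : fieldType) (A B R : comKAlgType k)
    (jR : A -> R) (f : B -> R) : is_alghom jR -> is_alghom f ->
  exists2 phi : tensor A B -> R, is_alghom phi &
    forall a b, phi (tens a b) = jR a * f b.
Proof.
move=> [jL [j1 jM]] [fL [f1 fM]].
pose h (x : tensor_presentation A B) : R := jR x.1 * f x.2.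
have hP l x y z : genrel l x y z -> h z = l *: h x + h y.
  case=> [a1 a2 b|a b1 b2]; rewrite /h /=.
    by rewrite jL mulrDl -scale_mull.
  by rewrite fL mulrDr -scale_mulr.
exists (plift h); last by move=> a b; rewrite plift_gen.
apply: plift_alghom hP _ _ => [|x y]; first by rewrite /h /= j1 f1 mulr1.
by rewrite /h /= jM fM mulrACA.
Qed.

(** * Evaluation of decorated trees *)

(** The automatic principle ignores the subtrees nested in the list of
    branches; here [Q] speaks of lists of branches. *)
Lemma ptree_forest_ind (Omega C : Type) (P : ptree Omega C -> Prop)
    (Q : seq (Omega * ptree Omega C) -> Prop) :
  (forall c s, Q s -> P (PNode c s)) ->
  Q [::] -> (forall w t s, P t -> Q s -> Q ((w, t) :: s)) ->
  forall s, Q s.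
Proof.
move=> PN Q0 QS.
have rec : forall t, P t := fix rec t : P t :=
  let: PNode c s := t in
  PN c s ((fix recs r : Q r :=
    match r with
    | [::] => Q0
    | b :: r' => let: (w, u) := b in QS w u r' (rec u) (recs r')
    end) s).
by elim=> [//|[w t] s IH]; exact: QS.
Qed.

Section Evaluation.
Variables (k : fieldType) (Omega : Type) (C : comKAlgType k).
Variables (R : opAlg k Omega) (phi : C -> R).
Hypothesis phi_alghom : is_alghom phi.

(** The product over the branches is a fold rather than a [\prod], which is
    opaque and would hide that the recursive calls are on subtrees. *)
Fixpoint ptree_eval (t : ptree Omega C) : R :=
  let: PNode c s := t in
  phi c * foldr (fun b r => oper R b.1 (ptree_eval b.2) * r) 1 s.

Let branches_eval (s : seq (Omega * ptree Omega C)) : R :=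
  foldr (fun b r => oper R b.1 (ptree_eval b.2) * r) 1 s.

Let ptree_evalE c s : ptree_eval (PNode c s) = phi c * branches_eval s.
Proof. by []. Qed.

Let branches_eval_cons w t s :
  branches_eval ((w, t) :: s) = oper R w (ptree_eval t) * branches_eval s.
Proof. by []. Qed.

Let branches_eval_cat s r :
  branches_eval (s ++ r) = branches_eval s * branches_eval r.
Proof. by elim: s => [|b s IH] /=; rewrite ?mul1r // IH mulrA. Qed.

Lemma ptree_eval_reorder t u : reorder t u -> ptree_eval t = ptree_eval u.
Proof.
elim=> {t u} // [t u v _ -> _ -> //|c s1 [v1 t1] [v2 t2] s2|c s1 w t u s2 _ tu].
  rewrite !ptree_evalE !branches_eval_cat !branches_eval_cons.
  by congr (_ * (_ * _)); rewrite mulrCA.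
by rewrite !ptree_evalE !branches_eval_cat !branches_eval_cons tu.
Qed.

Lemma ptree_eval_merge t u :
  ptree_eval (pmerge t u) = ptree_eval t * ptree_eval u.
Proof.
case: phi_alghom => _ [_ phiM]; case: t u => [c s] [d r].
by rewrite !ptree_evalE branches_eval_cat phiM mulrACA.
Qed.

Lemma ptree_eval_rel l t1 t2 t : ptree_rel l t1 t2 t ->
  ptree_eval t = l *: ptree_eval t1 + ptree_eval t2.
Proof.
case: phi_alghom => phiL _; elim=> {t1 t2 t} [c1 c2 s|c s1 w t1 t2 t s2 _ IH].
  by rewrite !ptree_evalE phiL mulrDl -scale_mull.
rewrite !ptree_evalE !branches_eval_cat !branches_eval_cons IH linearP.
by rewrite mulrDl !mulrDr -scale_mull -!scale_mulr.
Qed.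

Definition tree_eval : tree_alg Omega C -> R :=
  plift (fun T : tree_presentation Omega C => ptree_eval (repr T)).

Let eval_repr t : ptree_eval (repr (tcls t)) = ptree_eval t.
Proof. by apply: ptree_eval_reorder; exact: repr_tcls. Qed.

Let eval_rel l (x y z : tree_presentation Omega C) : genrel l x y z ->
  ptree_eval (repr z) = l *: ptree_eval (repr x) + ptree_eval (repr y).
Proof. by case=> t1 t2 t rt; rewrite !eval_repr; exact: ptree_eval_rel. Qed.

Lemma tree_eval_tgen t : tree_eval (tgen (tcls t)) = ptree_eval t.
Proof. by rewrite /tree_eval (plift_gen eval_rel) eval_repr. Qed.

Lemma tree_eval_alghom : is_alghom tree_eval.
Proof.
apply: plift_alghom eval_rel _ _ => [|T U] /=.
  by case: phi_alghom => _ [phi1 _]; rewrite eval_repr ptree_evalE phi1 mulr1.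
by rewrite eval_repr ptree_eval_merge.
Qed.

Lemma tree_eval_dot c : tree_eval (tgen (dot Omega c)) = phi c.
Proof. by rewrite tree_eval_tgen /= mulr1. Qed.

Lemma tree_eval_graft w T :
  tree_eval (tgen (graft w T)) = oper R w (tree_eval (tgen T)).
Proof.
case: phi_alghom => _ [phi1 _].
by elim/tcls_ind: T => t; rewrite graftE !tree_eval_tgen /= phi1 mul1r mulr1.
Qed.
End Evaluation.

(** * Building trees by products and grafting *)

Section TreeDecomposition.
Variables (k : fieldType) (Omega : Type) (C : comKAlgType k).

Lemma tgen_root (c : C) (s : seq (Omega * ptree Omega C)) :
  tgen (tcls (PNode c s)) = tgen (dot Omega c) * tgen (tcls (PNode 1 s)).
Proof. by rewrite -tgenM mergeE /= mulr1. Qed.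

Lemma tgen_branch w (t : ptree Omega C) s :
  tgen (tcls (PNode 1 ((w, t) :: s))) =
  tgen (graft w (tcls t)) * tgen (tcls (PNode 1 s)).
Proof. by rewrite -tgenM graftE mergeE /= mulr1. Qed.

(** The number of branches at the root does not depend on the planar
    representative. *)
Lemma branches_neq_dot (c d : C) (b : Omega * ptree Omega C) s :
  tcls (PNode c (b :: s)) <> dot Omega d.
Proof.
pose deg (t : ptree Omega C) := let: PNode _ r := t in size r.
have degE t u : reorder t u -> deg t = deg u.
  elim=> {t u} // [t u v _ -> _ -> //|e s1 b1 b2 s2|e s1 w t u s2 _ _] /=.
    by rewrite !size_cat.
  by rewrite !size_cat.
by move=> /tclsP /degE.
Qed.

(** A childless branch is a leaf of the tree that carries it, so it meets the
    condition that a one-vertex tree satisfies in [E^+]; for the other branches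
    both notions of leaves agree. *)
Lemma branch_in_Eplus (Cp : C -> Prop) (t : ptree Omega C) :
  (forall c, c \in branch_leaves t -> Cp c) -> in_Eplus Cp (tcls t).
Proof.
case: t => c [|b s] Ct.
  by left; exists c => //; apply: Ct; rewrite /= inE.
by right; split; [exists (PNode c (b :: s)) | move=> d; exact: branches_neq_dot].
Qed.

Lemma in_Eplus_in_E (Cp : C -> Prop) (T : tree Omega C) :
  in_Eplus Cp T -> in_E Cp T.
Proof. by case=> [[c _ ->]|[]] //; exact: dot_in_E. Qed.

(** A tree is the product of its root and of its branches, each grafted on a
    root decorated by [1]; by [branch_in_Eplus] only trees of [E^+] get grafted.
    Closure of [Q] under products is asked for factors in the span of [E] only,
    so that [Q] may speak of the subalgebra. *)
Lemma E_tree_ind (Cp : C -> Prop) (Q : tree_alg Omega C -> Prop) :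
  (forall c, Q (tgen (dot Omega c))) ->
  (forall x y, x \in Espan Cp -> y \in Espan Cp -> Q x -> Q y -> Q (x * y)) ->
  (forall w T, in_Eplus Cp T -> Q (tgen T) -> Q (tgen (graft w T))) ->
  forall T, in_E Cp T -> Q (tgen T).
Proof.
move=> Qdot QM Qgraft T [[c s] -> Es].
pose Eleaves (r : seq (Omega * ptree Omega C)) := forall d,
  d \in flatten [seq branch_leaves b.2 | b <- r] -> Cp d.
have EN d r : Eleaves r -> tgen (tcls (PNode d r)) \in Espan Cp.
  by move=> Er; apply: tgen_Espan; exists (PNode d r).
have QN d r : Eleaves r -> Q (tgen (tcls (PNode 1 r))) ->
    Q (tgen (tcls (PNode d r))).
  move=> Er Qr; rewrite tgen_root; apply: QM => //; last exact: EN.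
  exact/tgen_Espan/dot_in_E.
suff QS r : Eleaves r -> Q (tgen (tcls (PNode 1 r))).
  by apply: QN => //; exact: QS.
move: r; apply: (@ptree_forest_ind _ _ (fun t =>
  (forall d, d \in branch_leaves t -> Cp d) -> Q (tgen (tcls t))))
  => [d [|b r] Qr Er|_|w t r Qt Qr Er].
- exact: Qdot.
- by apply: QN => //; exact: Qr.
- exact: Qdot.
have Et d : d \in branch_leaves t -> Cp d.
  by move=> dt; apply: Er; rewrite /= mem_cat dt.
have Er' : Eleaves r.
  by move=> d dr; apply: Er; rewrite /= mem_cat dr orbT.
rewrite tgen_branch; apply: QM; first last.
- exact: Qr.
- by apply: Qgraft; [exact: branch_in_Eplus | exact: Qt].
- exact: EN.
apply: tgen_Espan; rewrite graftE; exists (PNode 1 [:: (w, t)]) => //= d.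
by rewrite cats0; exact: Et.
Qed.
End TreeDecomposition.

(** * The universal property *)

Section Freeness.
Variables (k : fieldType) (Omega : Type) (A : opAlg k Omega).
Variables (B : comKAlgType k) (Bp : B -> Prop) (augB : augmentation Bp).

Local Notation F := (free_opAlg A augB).
Local Notation Ap := (tensor_plus (A := A) Bp).

Let in_A (a : A) : F := E_dot Omega Ap (tens a 1).
Let in_B (b : B) : F := E_dot Omega Ap (tens 1 b).

Let val_P (l : k) (x y : F) : E_val (l *: x + y) = l *: E_val x + E_val y.
Proof. by case: (E_val_alghom Omega Ap) => vL _; rewrite vL. Qed.

Lemma E_dot_linear : linear (E_dot Omega Ap : tensor A B -> F).
Proof.
move=> l c d; apply: E_valI; rewrite val_P.
by apply: tgen_rel; exact: ptree_rel_root.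
Qed.

Lemma E_dotM c d : E_dot Omega Ap (c * d) = E_dot Omega Ap c * E_dot Omega Ap d.
Proof. by apply: E_valI; rewrite E_valM /= -tgenM mergeE. Qed.

Lemma E_dot1 : E_dot Omega Ap 1 = 1.
Proof. exact: E_valI. Qed.

Lemma E_span_ind (Q : F -> Prop) :
  Q 0 -> (forall l x y, Q x -> Q y -> Q (l *: x + y)) ->
  (forall T x, in_E Ap T -> E_val x = tgen T -> Q x) ->
  forall x, Q x.
Proof.
move=> Q0 QP QT x.
suff QE u : Defs.span (fun y => exists2 T, in_E Ap T & y = tgen T) u ->
    forall y : F, E_val y = u -> Q y by exact: (QE (E_val x) (EspanP _ _ (E_valP x))).
elim=> {x u} [x x0|l _ v [T ET ->] Ev IH x xE].
  by have -> : x = 0 by exact: E_valI.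
pose xT : F := EAlg (tgen_Espan ET).
pose xv : F := EAlg (introT (EspanP _ _) Ev).
have -> : x = l *: xT + xv by apply: E_valI; rewrite val_P.
by apply: QP; [exact: (QT T) | exact: IH].
Qed.

(** A one-vertex tree decorated by [a (x) b] is the product of the images of
    [a] and [b]; larger trees arise by products and [Gamma_w]. *)
Lemma free_opAlg_ind (Q : F -> Prop) :
  (forall a, Q (in_A a)) -> (forall b, Q (in_B b)) ->
  (forall l x y, Q x -> Q y -> Q (l *: x + y)) ->
  (forall x y, Q x -> Q y -> Q (x * y)) ->
  (forall w x, Q x -> Q (oper F w x)) ->
  forall x, Q x.
Proof.
move=> QA QB QP QM Qop.
have Q0 : Q 0 by have := QP (-1) _ _ (QA 0) (QA 0); rewrite scaleN1r addNr.
have Qdot c : Q (E_dot Omega Ap c).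
  elim/tensor_ind: c => [|l a b u IH].
    suff -> : E_dot Omega Ap 0 = 0 by [].
    by have := E_dot_linear (-1) 0 0; rewrite scaler0 addr0 scaleN1r addNr.
  rewrite E_dot_linear; apply: QP => //.
  by rewrite -[a]mulr1 -[b]mul1r -tensM E_dotM; apply: QM; [exact: QA | exact: QB].
apply: E_span_ind => // T x ET.
apply: (E_tree_ind (Q := fun u => forall x : F, E_val x = u -> Q x) _ _ _ ET)
  => {T x ET} [c x xc|u v Eu Ev Qu Qv x xuv|w T ET QT x xT].
- by have -> : x = E_dot Omega Ap c by exact: E_valI.
- pose xu : F := EAlg Eu; pose xv : F := EAlg Ev.
  have -> : x = xu * xv by apply: E_valI; rewrite xuv E_valM.
  by apply: QM; [exact: Qu | exact: Qv].
- pose y : F := EAlg (tgen_Espan (in_Eplus_in_E ET)).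
  have -> : x = oper F w y.
    by apply: E_valI; rewrite xT (proj2 (GammaP A augB w) _ _ ET).
  by apply: Qop; exact: QT.
Qed.

Lemma in_A_ophom : is_ophom in_A.
Proof.
split; last by move=> w a; exact/esym/(proj1 (GammaP A augB w)).
split; first by move=> l a a'; rewrite /in_A tensPl E_dot_linear.
by split=> [|a a']; [exact: E_dot1 | rewrite /in_A -E_dotM tensM mulr1].
Qed.

Lemma in_B_alghom : is_alghom in_B.
Proof.
split; first by move=> l b b'; rewrite /in_B tensPr E_dot_linear.
by split=> [|b b']; [exact: E_dot1 | rewrite /in_B -E_dotM tensM mulr1].
Qed.

(** [Gamma_w] is specified on the one-vertex trees decorated by [A], where
    commutation is the hypothesis on [phi], and on [E^+], where it grafts.
    [tensor_proj] splits a general one-vertex tree into these two kinds. *)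
Lemma tree_eval_Gamma (R : opAlg k Omega) (phi : tensor A B -> R) :
  is_alghom phi ->
  (forall w a, phi (tens (oper A w a) 1) = oper R w (phi (tens a 1))) ->
  forall w (x : F), tree_eval phi (E_val (oper F w x)) =
    oper R w (tree_eval phi (E_val x)).
Proof.
move=> phi_alghom phi_op w x.
have [eL _] := tree_eval_alghom phi_alghom.
have ev0 : tree_eval phi 0 = 0.
  by have := eL (-1) 0 0; rewrite scaler0 addr0 scaleN1r addNr.
pose good (x : F) :=
  tree_eval phi (E_val (oper F w x)) = oper R w (tree_eval phi (E_val x)).
have good0 : good 0 by rewrite /good linear0 ev0 linear0.
have goodP l y z : good y -> good z -> good (l *: y + z).
  by rewrite /good linearP !val_P !eL linearP => -> ->.
have [GA GT] := GammaP A augB w.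
have good_Eplus T (y : F) : in_Eplus Ap T -> E_val y = tgen T -> good y.
  by move=> ET yT; rewrite /good (GT T y ET yT) tree_eval_graft // yT.
have good_dot c : good (E_dot Omega Ap c).
  have [p _ [_ _ pP]] := tensor_proj A augB.
  have -> : E_dot Omega Ap c =
      1 *: in_A (p c) + E_dot Omega Ap (c - tens (p c) 1).
    by rewrite -E_dot_linear scale1r addrC subrK.
  apply: goodP.
    by rewrite /good /in_A [oper F w _]GA !tree_eval_dot.
  apply: (good_Eplus (dot Omega (c - tens (p c) 1))) => //.
  by left; exists (c - tens (p c) 1).
rewrite -/(good x); apply: E_span_ind => // T {}x ET xT.
have [[c Tc]|ndot] := pselect (exists c, T = dot Omega c).
  by have -> : x = E_dot Omega Ap c by apply: E_valI; rewrite xT Tc.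
by apply: (good_Eplus T) => //; right; split=> // c Tc; apply: ndot; exists c.
Qed.
End Freeness.

Theorem corollary3p11 (k : fieldType) (char0 : [pchar k] =i pred0)
    (Omega : Type) (Omega_nonempty : inhabited Omega)
    (A : opAlg k Omega) (B : comKAlgType k) (Bp : B -> Prop)
    (augB : augmentation Bp) :
  @is_free_over k Omega A B (free_opAlg A augB)
    (fun a : A => E_dot Omega (tensor_plus Bp) (tens a 1))
    (fun b : B => E_dot Omega (tensor_plus Bp) (tens 1 b)).
Proof.
split; [exact: in_A_ophom | exact: in_B_alghom |].
move=> R jR f [jR_alghom jR_op] f_alghom.
have [phi phi_alghom phiE] := tensor_alghom jR_alghom f_alghom.
have [[jL [j1 _]] [fL [f1 _]]] := (jR_alghom, f_alghom).
have phi_A a : phi (tens a 1) = jR a by rewrite phiE f1 mulr1.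
have phi_B b : phi (tens 1 b) = f b by rewrite phiE j1 mul1r.
have [eL [e1 eM]] := tree_eval_alghom phi_alghom.
have [vL [v1 vM]] := E_val_alghom Omega (tensor_plus (A := A) Bp).
exists (fun x => tree_eval phi (E_val x)); split.
  split=> [|a|b].
  - split.
      split; first by move=> l x y; rewrite vL eL.
      by split=> [|x y]; [rewrite v1 e1 | rewrite vM eM].
    by apply: tree_eval_Gamma => // w a; rewrite !phi_A jR_op.
  - by rewrite /= tree_eval_dot // phi_A.
  - by rewrite /= tree_eval_dot // phi_B.
move=> g [[[gL [_ gM]] g_op] gA gB]; apply: funext.
elim/free_opAlg_ind => [a|b|l x y IHx IHy|x y IHx IHy|w x IH].
- by rewrite gA /= tree_eval_dot.
- by rewrite gB /= tree_eval_dot.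
- by rewrite gL vL eL IHx IHy.
- by rewrite gM vM eM IHx IHy.
- rewrite g_op tree_eval_Gamma ?IH // => v a.
  by rewrite !phi_A jR_op.
Qed.
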